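(* Fix $\alpha>0$ and let $r\in\mathbb{N}$. For any $0<\epsilon<1$ there exists an MLP neural network $\tilde{u}$, with $\tanh$ nonlinearities and $O(\epsilon^{-3/r}+\epsilon^{-1/r}\log^{2}(\epsilon^{-(1+1/r)}))$ weights (the implied constant depending on $r$), for which the following holds. For any $f\in W_{2}^{r}([0,1])$ of the form $f(x)=\sum_{k=1}^{\infty}c_{k}\sin(2\pi kx)$ with $\|f^{(r)}\|_{L_2[0,1]}\leq1$, let $u$ be the solution of the heat equation $u_t=\alpha u_{xx}$ on $[0,1]$ with initial condition $u(\cdot,0)=f$, i.e. $u(f,x,t)=\sum_{k=1}^\infty e^{-4\pi^2k^2\alpha t}c_k\sin(2\pi kx)$. Then the network $\tilde{u}$, taking as input the coefficients $\{c_{k}\}_{k=1}^{K}$ with $K\ge c\,\epsilon^{-1/r}$ (for a suitable constant $c>0$), together with $t$ and $x$, provides an output $\tilde u(f,x,t)$ satisfying \[ \|u(f,\cdot,t)-\tilde{u}(f,\cdot,t)\|_{L_{2}[0,1]}\leq\epsilon\qquad\text{for all } t\in[0,1]. \]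
   Context: An MLP (multilayer perceptron) network is a feed-forward composition of layers, each of the form $v_j=\sigma\circ(M_j v_{j-1}+b_j)$ with a matrix $M_j$ and bias vector $b_j$ and coordinate-wise nonlinearity $\sigma$ (here $\sigma=\tanh$); in some layers the bias and/or the nonlinearity may be omitted. The ''number of weights'' is the total number of parameters. For $\Omega\subset\mathbb{R}^n$ and $1\le p<\infty$, the Sobolev space $W_p^r(\Omega)$ is the completion of the space $C_0^r(\Omega)$ of compactly supported $r$-times continuously differentiable functions with respect to the norm $\|f\|_{W_p^r(\Omega)}=\sum_{|\beta|\le r}\|\partial^\beta f\|_{L_p(\Omega)}$. *)

(* Defs.v *)
From HB Require Import structures.
From mathcomp Require Import all_boot all_order all_algebra.
From mathcomp Require Import all_classical all_reals all_analysis.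
Set Implicit Arguments. Unset Strict Implicit. Unset Printing Implicit Defensive.
Import Order.TTheory GRing.Theory Num.Theory.
Import numFieldNormedType.Exports.
Local Open Scope classical_set_scope.
Local Open Scope ring_scope.

Section Defs.
Variable R : realType.

Definition tanh (x : R) : R := (expR x - expR (- x)) / (expR x + expR (- x)).

Inductive mlp : nat -> nat -> Type :=
| mlp_nil n : mlp n n
| mlp_cons m n p (M : 'M[R]_(n, m)) (b : option 'cV[R]_n) (act : bool)
    (rest : mlp n p) : mlp m p.

Fixpoint mlp_eval m p (N : mlp m p) : 'cV[R]_m -> 'cV[R]_p :=
  match N in mlp m p return 'cV[R]_m -> 'cV[R]_p with
  | mlp_nil _ => fun v => v
  | mlp_cons m n p M b act rest => fun v =>
      let w := M *m v + (if b is Some b' then b' else 0) in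
      mlp_eval rest (if act then map_mx tanh w else w)
  end.

Fixpoint mlp_weights m p (N : mlp m p) : nat :=
  match N with
  | mlp_nil _ => 0
  | mlp_cons m n p M b act rest =>
      (n * m + (if b is Some _ then n else 0) + mlp_weights rest)%N
  end.

Definition L2norm01 (f : R -> R) : \bar R :=
  Lnorm (@lebesgue_measure R) 2%:E (EFin \o (f \_ `[0, 1])).

Definition Cr (r : nat) (phi : R -> R) : Prop :=
  (forall j, (j < r)%N -> forall x, derivable (derive1n j phi) x 1) /\
  continuous (derive1n r phi).

(** C_0^r((0,1)) : r-times continuously differentiable with compact support
    contained in the open interval (0,1) (extended by zero to R). *)
Definition C0r (r : nat) (phi : R -> R) : Prop :=
  Cr r phi /\
  exists a b : R, [/\ 0 < a, b < 1 &
                   forall x, x \notin `[a, b] -> phi x = 0].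

(** W_2^r((0,1)) = completion of C_0^r((0,1)) w.r.t.
    sum_{j<=r} ||phi^(j)||_{L_2}.  [sobolev2 r f g] : f belongs to
    W_2^r and g is (a representative of) its r-th derivative, i.e. there is a
    sequence phi_n in C_0^r, Cauchy in the W_2^r norm, i.e. with each
    phi_n^(j) converging in L_2[0,1] to some g_j, where g_0 = f, g_r = g. *)
Definition sobolev2 (r : nat) (f g : R -> R) : Prop :=
  exists (phi : nat -> R -> R) (gs : nat -> R -> R),
    [/\ forall n, C0r r (phi n),
        forall j, (j <= r)%N -> measurable_fun (`[0, 1] : set R) (gs j),
        forall j, (j <= r)%N ->
          (fun n => L2norm01 (derive1n j (phi n) \- gs j)) @ \oo --> 0%E,
        gs 0%N = f & gs r = g].

Definition sine_partial (c : nat -> R) (N : nat) (x : R) : R :=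
  \sum_(1 <= k < N.+1) c k * sin (2 * pi * k%:R * x).

Definition heat_sol (alpha : R) (c : nat -> R) (x t : R) : R :=
  limn (fun N => \sum_(1 <= k < N.+1)
          expR (- (4 * pi ^+ 2 * (k%:R) ^+ 2 * alpha * t)) * c k
            * sin (2 * pi * k%:R * x)).

Definition net_input (K : nat) (c : nat -> R) (t x : R) : 'cV[R]_(K + 2) :=
  \col_(i < K + 2)
    (if (i < K)%N then c i.+1 else if i == K :> nat then t else x).

Definition net_out (K : nat) (N : mlp (K + 2) 1) (c : nat -> R) (x t : R) : R :=
  mlp_eval N (net_input K c t x) ord0 ord0.

End Defs.

(* Main.v *)
(** The [K]-th Fourier partial sum
    [sum_(k <= K) c_k e^{-4 pi^2 k^2 alpha t} sin (2 pi k x)] with [K ~ eps^(-1/r)]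
    of [u] is within [eps / 2] of [u] in [L_2]: integrating the compactly supported
    approximants of [f] by parts [r] times and applying Bessel's inequality to
    the [r]-th derivative gives [sum_k (2 pi k)^(2r) c_k^2 / 2 <= 1].

    The partial sum is a uniform limit of networks with one hidden layer of
    width [O(K^2)], hence [O(K^3)] weights.  On [0, 1], [sin (2 pi k x)] is
    exponentially close to its Taylor polynomial of degree [O(K)].  With
    [y_h z = (e^{hz} - 1) / h], which tends to [z] as [h -> 0], replacing [c_k]
    by [y_h c_k] and [x] by [y_h x] turns each product [c_k e^{-at} x^j] into a
    combination of exponentials of linear forms in the input.  Finally one tanh
    neuron yields an exponential, because
    [e^{2s} / 2 (1 - tanh (s - z / 2)) -> e^z] as [s -> +oo]. *)

Require Import Defs.
From HB Require Import structures.
From mathcomp Require Import all_boot all_order all_algebra.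
From mathcomp Require Import all_classical all_reals all_analysis.
From mathcomp Require Import measurable_realfun zify ring lra.
Import Order.TTheory GRing.Theory Num.Theory.
Import numFieldNormedType.Exports.
Local Open Scope classical_set_scope.
Local Open Scope ring_scope.

(** * Shallow networks *)

(** With p = e^s and q = e^{z/2}, [tanh (s - z / 2)] equals (p^2 - q^2) / (p^2 + q^2), so the error
    is exactly q^4 / (p^2 + q^2), which is at most e^{2Z} / p^2. Only an upper bound on z enters, so
    the estimate stays uniform as z tends to minus infinity. *)
Lemma expR_tanh_approx (R : realType) (Z z s : R) : z <= Z ->
  `|expR (2 * s) / 2 * (1 - tanh (s - z / 2)) - expR z|
    <= expR (2 * Z) * expR (- (2 * s)).
Proof.
move=> zZ; set p := expR s; set q := expR (z / 2).
have p0 : 0 < p by exact: expR_gt0.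
have q0 : 0 < q by exact: expR_gt0.
have -> : expR (2 * s) = p ^+ 2 by rewrite mulr_natl mulr2n expRD expr2.
have -> : expR z = q ^+ 2 by rewrite expr2 -expRD -splitr.
have pq0 : 0 < p ^+ 2 + q ^+ 2 by rewrite addr_gt0// exprn_gt0.
have -> : tanh (s - z / 2) = (p ^+ 2 - q ^+ 2) / (p ^+ 2 + q ^+ 2).
  rewrite /tanh opprB !expRB -/p -/q; field.
  by rewrite ?gt_eqF.
have -> : p ^+ 2 / 2 * (1 - (p ^+ 2 - q ^+ 2) / (p ^+ 2 + q ^+ 2)) - q ^+ 2
    = - (q ^+ 4 / (p ^+ 2 + q ^+ 2)) by field; rewrite gt_eqF.
rewrite normrN ger0_norm; last by rewrite divr_ge0 ?exprn_ge0 ?(ltW q0) ?(ltW pq0).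
have qZ : q ^+ 4 <= expR (2 * Z).
  rewrite /q -expRM_natl ler_expR mulr_natl; lra.
have -> : expR (- (2 * s)) = (p ^+ 2)^-1.
  by rewrite expRN mulr_natl mulr2n expRD -expr2.
apply: ler_pM; rewrite ?invr_ge0 ?exprn_ge0 ?(ltW q0) ?(ltW pq0)//.
by rewrite lef_pV2 ?posrE ?exprn_gt0// lerDl exprn_ge0 ?(ltW q0).
Qed.

(** One hidden tanh neuron per exponential; the constants of all neurons are collected in the output
    bias. Greater accuracy only enlarges the values of the weights, so their number does not depend
    on [d]. *)
Lemma exp_sum_mlp (R : realType) (m n : nat) (M : 'M[R]_(m, n))
    (w : 'I_m -> R) (Z d : R) : 0 < d ->
  exists N : mlp R n 1,
    mlp_weights N = (m * n + m + (m + 1))%N /\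
    forall v : 'cV[R]_n, (forall i, (M *m v) i ord0 <= Z) ->
      `|mlp_eval N v ord0 ord0 - \sum_i w i * expR ((M *m v) i ord0)| <= d.
Proof.
move=> d0; pose S := \sum_i `|w i|.
have S0 : 0 <= S by exact: sumr_ge0.
pose D := S * expR (2 * Z) + 1.
have D0 : 0 < D by rewrite ltr_wpDl// mulr_ge0// expR_ge0.
(* Chosen so that e^{-2s} = d / D; the total error S e^{2Z} e^{-2s} is then below [d]. The summand 1
   in [D] keeps it positive even when all [w i] vanish. *)
pose s := - ln (d / D) / 2.
have sE : expR (- (2 * s)) = d / D.
  have -> : - (2 * s) = ln (d / D) by rewrite /s; lra.
  by rewrite lnK// posrE divr_gt0.
pose e := expR (2 * s) / 2.
exists (mlp_cons ((- 2^-1) *: M) (Some (const_mx s)) true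
  (mlp_cons (\row_i (- (e * w i))) (Some (const_mx (e * \sum_i w i))) false
    (mlp_nil R 1))).
split; first by rewrite /= mul1n addn0.
move=> v vZ /=; rewrite !mxE.
under [X in `|X + _ - _|]eq_bigr => i _ do rewrite !mxE.
rewrite mulr_sumr -big_split /= -sumrB.
apply: le_trans (ler_norm_sum _ _ _) _.
have bnd i : `|- (e * w i) * tanh (\sum_j ((- 2^-1) *: M) i j * v j ord0 + s) + e * w i
    - w i * expR ((M *m v) i ord0)| <= `|w i| * (expR (2 * Z) * (d / D)).
  have -> : \sum_j ((- 2^-1) *: M) i j * v j ord0 + s = s - (M *m v) i ord0 / 2.
    rewrite addrC mxE mulr_suml -sumrN; congr (_ + _); apply: eq_bigr => j _.
    by rewrite mxE; lra.
  set z := (M *m v) i ord0.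
  have -> : - (e * w i) * tanh (s - z / 2) + e * w i - w i * expR z
     = w i * (e * (1 - tanh (s - z / 2)) - expR z) by ring.
  rewrite normrM ler_wpM2l// -sE; exact/expR_tanh_approx/vZ.
apply: le_trans (ler_sum _ (fun i _ => bnd i)) _.
rewrite -mulr_suml -/S !mulrA ler_pdivrMr// /D mulrDr mulr1 [leLHS]mulrC lerDl.
exact: ltW.
Qed.

(** The tangent bound at -y gives e^y (1 - y) <= e^y e^{-y} = 1, an upper bound on e^y to match the
    lower bound 1 + y. *)
Lemma expR_quad_bound (R : realType) (y : R) : `|y| <= 2^-1 ->
  `|expR y - 1 - y| <= 2 * y ^+ 2.
Proof.
move=> y1.
have h1 : 1 + y <= expR y by exact/expR_ge1Dx.
have h2 : 1 - y <= expR (- y) by exact/expR_ge1Dx.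
rewrite ger0_norm; last by lra.
move: y1; rewrite ler_norml => /andP[y1 y2].
have e0 := expR_gt0 y.
have ee : expR y * expR (- y) = 1 by rewrite -expRD subrr expR0.
have h3 : expR y * (1 - y) <= 1 by rewrite -[leRHS]ee ler_pM2l.
nra.
Qed.

(** Induction along Horner's scheme, with a single constant for both size and slope. The interval
    [-2, 2] contains all values of (e^{hz} - 1) / h with |z| <= 1 and 0 < h <= 1/4. *)
Lemma poly_lipschitz2 (R : realType) (p : {poly R}) :
  exists B : R, 0 <= B /\ forall x y, `|x| <= 2 -> `|y| <= 2 ->
    `|p.[x]| <= B /\ `|p.[x] - p.[y]| <= B * `|x - y|.
Proof.
elim/poly_ind: p => [|p c [B [B0 IH]]].
  exists 0; split => // x y _ _.
  by rewrite !horner0 subrr normr0 mul0r.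
exists (3 * B + `|c|); split; first by rewrite addr_ge0// mulr_ge0.
move=> x y x2 y2; have [h1 h2] := IH x y x2 y2; have [h3 _] := IH y x y2 x2.
rewrite !hornerMXaddC; split.
  apply: le_trans (ler_normD _ _) _; rewrite lerD2r normrM.
  have := normr_ge0 x; have := normr_ge0 p.[x]; nra.
have -> : p.[x] * x + c - (p.[y] * y + c)
    = (p.[x] - p.[y]) * x + p.[y] * (x - y) by ring.
apply: le_trans (ler_normD _ _) _; rewrite !normrM.
have t0 := normr_ge0 (x - y); have c0 := normr_ge0 c.
have a1 : `|p.[x] - p.[y]| * `|x| <= B * `|x - y| * 2.
  by apply: ler_pM.
have a2 : `|p.[y]| * `|x - y| <= B * `|x - y| by rewrite ler_wpM2r.
nra.
Qed.

Lemma exp_quotient_approx (R : realType) (h z : R) : 0 < h <= 4^-1 -> `|z| <= 1 ->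
  `|(expR (h * z) - 1) / h - z| <= 2 * h /\ `|(expR (h * z) - 1) / h| <= 2.
Proof.
move=> /andP[h0 h4] z1.
have hz : `|h * z| <= 2^-1.
  by rewrite normrM gtr0_norm//; have := normr_ge0 z; nra.
have q := expR_quad_bound _ _ hz.
have b : `|(expR (h * z) - 1) / h - z| <= 2 * h.
  have -> : (expR (h * z) - 1) / h - z = (expR (h * z) - 1 - h * z) / h.
    by field; rewrite gt_eqF.
  rewrite normrM normfV (gtr0_norm h0) ler_pdivrMr//.
  apply: le_trans q _.
  have : z ^+ 2 <= 1 by rewrite -real_normK ?num_real// expr_le1.
  by rewrite exprMn; have := sqr_ge0 h; nra.
split => //.
rewrite -[X in `|X|](subrK z); apply: le_trans (ler_normD _ _) _; lra.
Qed.

Lemma exp_quotient_sum_approx (R : realType) (K : nat) (p : 'I_K -> {poly R}) (d : R) :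
  0 < d -> exists h : R, 0 < h <= 4^-1 /\
  forall (c E : 'I_K -> R) (x : R), (forall k, `|c k| <= 1) ->
    (forall k, 0 <= E k <= 1) -> 0 <= x <= 1 ->
  `|\sum_k ((expR (h * c k) - 1) / h) * E k * (p k).[(expR (h * x) - 1) / h]
    - \sum_k c k * E k * (p k).[x]| <= d.
Proof.
move=> d0.
have [B hB] := choice (fun k => poly_lipschitz2 _ (p k)).
pose S := \sum_k B k.
have S0 : 0 <= S by apply: sumr_ge0 => k _; case: (hB k).
(* Each summand is off by at most 4 h [B k]: half from replacing [c k], half from replacing [x].
   Hence 4 h S <= d is what is needed, and [h] depends neither on [c] and [E] nor on [x]. *)
pose h := Num.min 4^-1 (d / (4 * S + 1)).
have S1 : 0 < 4 * S + 1 by lra.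
have h0 : 0 < h by rewrite lt_min invr_gt0 divr_gt0//; lra.
have h4 : h <= 4^-1 by rewrite ge_min lexx.
have hS : h * (4 * S) <= d.
  have : h <= d / (4 * S + 1) by rewrite ge_min lexx orbT.
  by rewrite ler_pdivlMr// => ?; nra.
exists h; split; first by rewrite h0.
move=> c E x c1 E1 /andP[x0 x1].
have h04 : 0 < h <= 4^-1 by rewrite h0.
have ax1 : `|x| <= 1 by rewrite ger0_norm.
have [y1 y2] := exp_quotient_approx _ _ _ h04 ax1.
rewrite -sumrB; apply: le_trans (ler_norm_sum _ _ _) _; apply: le_trans hS.
rewrite mulrA mulr_sumr; apply: ler_sum => k _.
have [z1 z2] := exp_quotient_approx _ _ _ h04 (c1 k).
set yx := (expR (h * x) - 1) / h in y1 y2 *.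
set yc := (expR (h * c k) - 1) / h in z1 z2 *.
have [B0 HB] := hB k.
have ax2 : `|x| <= 2 by lra.
have [P1 P2] := HB yx x y2 ax2.
have [Q1 _] := HB x x ax2 ax2.
have /andP[E0 EE] := E1 k.
have -> : yc * E k * (p k).[yx] - c k * E k * (p k).[x]
  = E k * ((yc - c k) * (p k).[yx] + c k * ((p k).[yx] - (p k).[x])) by ring.
rewrite normrM ger0_norm//.
have b1 : `|(yc - c k) * (p k).[yx] + c k * ((p k).[yx] - (p k).[x])|
   <= 2 * h * B k + 1 * (B k * (2 * h)).
  apply: le_trans (ler_normD _ _) _; rewrite !normrM.
  apply: lerD; first exact: ler_pM.
  apply: ler_pM => //; apply: le_trans P2 _.
  by rewrite ler_wpM2l.
have n0 := normr_ge0 ((yc - c k) * (p k).[yx] + c k * ((p k).[yx] - (p k).[x])).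
nra.
Qed.

(** Evaluates one row of a first-layer matrix: the coordinates split into the K coefficients, then
    [t], then [x]. *)
Lemma net_input_dot (R : realType) (K : nat) (u : 'I_K -> R) (a b : R)
    (c : nat -> R) (t x : R) :
  \sum_(j < K + 2) (match fintype.split j with
                    | inl k => u k
                    | inr e => if e == ord0 then a else b
                    end) * net_input K c t x j ord0
  = \sum_(k < K) u k * c k.+1 + (a * t + b * x).
Proof.
rewrite big_split_ord /=; congr (_ + _).
  apply: eq_bigr => k _; rewrite (unsplitK (inl k : 'I_K + 'I_2)%type) mxE /=.
  by rewrite ltn_ord.
rewrite big_ord_recl big_ord1 /=.
rewrite !(unsplitK (inr _ : 'I_K + 'I_2)%type) !mxE /=.
by rewrite !addn0 ltnn eqxx ltnNge leq_addr /= -[X in _ == X]addn0 eqn_add2l.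
Qed.

(** After the exponential substitution each of the K summands expands into 2J exponentials of linear
    forms: two from e^{h c} - 1 and J from the polynomial. Hence 2KJ hidden neurons on K + 2 inputs,
    with 2KJ(K + 2) + 2KJ + 2KJ + 1 weights. *)
Lemma heat_poly_mlp (R : realType) (K J : nat) (a : nat -> R)
    (p : nat -> {poly R}) (d : R) : 0 < d ->
  (forall k, 0 <= a k) -> (forall k, (size (p k) <= J)%N) ->
  exists N : mlp R (K + 2) 1,
    mlp_weights N = (2 * K * J * (K + 4) + 1)%N /\
    forall (c : nat -> R) (t x : R), (forall k, `|c k.+1| <= 1) ->
      0 <= t -> 0 <= x <= 1 ->
      `|net_out N c x t -
        \sum_(k < K) c k.+1 * expR (- (a k * t)) * (p k).[x]| <= d.
Proof.
move=> d0 a0 pJ.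
have d20 : 0 < d / 2 by rewrite divr_gt0.
have [h [h04 hP]] := exp_quotient_sum_approx R K (fun k => p k) _ d20.
have /andP[h0 h4] := h04.
(* p((e^{hx} - 1) / h) is a polynomial in e^{hx} of the same degree, and its powers e^{lhx} are
   exponentials of multiples of x. *)
pose q (k : nat) : {poly R} := p k \Po (h^-1 *: ('X - 1)).
have qJ k : (size (q k) <= J)%N.
  rewrite size_comp_poly2 //.
  by rewrite size_scale ?invr_eq0 ?gt_eqF // -polyC1 size_XsubC.
(* The boolean selects e^{h c} or the constant -1 in the factor e^{h c} - 1, [k] is the mode and [l]
   the power of e^{hx}. *)
pose I : finType := (bool * 'I_K * 'I_J)%type.
pose r (i : I) (j : 'I_(K + 2)) : R := let: (b, k, l) := i in
  match fintype.split j with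
  | inl k' => if b && (k' == k) then h else 0
  | inr e => if e == ord0 then - a k else h * (l : nat)%:R
  end.
pose M := \matrix_(i < #|I|, j < K + 2) r (enum_val i) j.
pose wt (i : I) : R := let: (b, k, l) := i in
  (if b then 1 else -1) * (q k)`_l / h.
pose lf (c : nat -> R) t x (i : I) : R := let: (b, k, l) := i in
  (if b then h * c k.+1 else 0) + (- a k * t + h * (l : nat)%:R * x).
have ME c t x i : (M *m net_input K c t x) i ord0 = lf c t x (enum_val i).
  rewrite mxE; under eq_bigr => j _ do rewrite mxE.
  case: (enum_val i) => [[b k] l] /=.
  rewrite (net_input_dot R K (fun k' => if b && (k' == k) then h else 0)).
  congr (_ + _); case: b => /=; last by rewrite big1 // => k' _; rewrite mul0r.
  rewrite (bigD1 k) //= eqxx big1 ?addr0 // => k' /negbTE ->.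
  by rewrite mul0r.
(* The exponents are at most 1 + J: the coefficient part is at most h <= 1, the time part is
   nonpositive, and h l x <= J. *)
have [N [NW NP]] := exp_sum_mlp R _ _ M (fun i => wt (enum_val i)) (1 + J%:R) _ d20.
exists N; split.
  rewrite NW !card_prod card_bool !card_ord; ring.
move=> c t x c1 t0 x01; have /andP[x0 x1] := x01.
have Zb i : (M *m net_input K c t x) i ord0 <= 1 + J%:R.
  rewrite ME; case: (enum_val i) => [[b k] l] /=.
  apply: lerD.
    case: b => //; have := c1 k; rewrite ler_norml => /andP[]; nra.
  have at0 : 0 <= a k * t by rewrite mulr_ge0.
  have l0 : 0 <= l%:R :> R by [].
  have lJ : l%:R <= J%:R :> R by rewrite ler_nat ltnW.
  have : h * l%:R * x <= 1 * J%:R * 1.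
    apply: ler_pM => //; first by rewrite mulr_ge0 // ltW.
    by apply: ler_pM => //; lra.
  lra.
have {NP} := NP _ Zb.
under eq_bigr => i _ do rewrite ME.
rewrite -(big_enum_val (fun i => wt i * expR (lf c t x i))) /=.
have -> : \sum_(i : I) wt i * expR (lf c t x i) =
  \sum_(k < K) ((expR (h * c k.+1) - 1) / h) * expR (- (a k * t)) *
     (p k).[(expR (h * x) - 1) / h].
  have -> : \sum_(i : I) wt i * expR (lf c t x i) =
      \sum_(b : bool) \sum_(k < K) \sum_(l < J) wt (b, k, l) * expR (lf c t x (b, k, l)).
    rewrite [RHS]pair_bigA pair_bigA.
    by apply: eq_bigr => -[[b k] l] _.
  rewrite big_bool /= -big_split /=; apply: eq_bigr => k _.
  have -> : (p k).[(expR (h * x) - 1) / h] = (q k).[expR (h * x)].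
    by rewrite /q horner_comp !hornerE mulrC.
  rewrite (horner_coef_wide _ (qJ k)) mulr_sumr -big_split /=.
  apply: eq_bigr => l _.
  rewrite add0r !expRD -expRM_natl [- a k * t]mulNr.
  have -> : h * l%:R * x = l%:R * (h * x) by ring.
  by ring.
move=> h1; apply: le_trans (ler_distD _ _ _) _.
rewrite [leRHS]splitr; apply: lerD h1 _.
apply: hP => // k; rewrite expR_ge0 -expR0 ler_expR oppr_le0.
by rewrite mulr_ge0.
Qed.

(** * Taylor polynomials of the sine and the network for the partial sums *)

Lemma cvg_dist_le (R : realType) (u : nat -> R) (l a B : R) (N : nat) :
  u @ \oo --> l -> (forall n, (N <= n)%N -> `|u n - a| <= B) -> `|l - a| <= B.
Proof.
move=> ul uB; apply: (@ler_cvg_to _ \oo _ _ (fun n => `|u n - a|) (cst B)).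
- by apply: cvg_norm; exact: (cvgB ul (cvg_cst _)).
- exact: cvg_cst.
- by exists N.
Qed.

(* Scaling the argument by [e] costs [e^-J] on the terms of index at least [J]. *)
Lemma sin_taylor_bound (R : realType) (y : R) (J : nat) : 0 <= y ->
  `|sin y - \sum_(i < J) sin_coeff y i| <= expR (expR 1 * y - J%:R).
Proof.
move=> y0; apply: (@cvg_dist_le _ (series (sin_coeff y)) _ _ _ J).
  by rewrite unlock; exact: is_cvg_series_sin_coeff.
move=> m Jm.
have -> : series (sin_coeff y) m - \sum_(i < J) sin_coeff y i
    = \sum_(J <= i < m) sin_coeff y i.
  by rewrite seriesEnat /= (big_cat_nat (leq0n J) Jm) big_mkord addrAC subrr add0r.
apply: le_trans (ler_norm_sum _ _ _) _.
set z := expR 1 * y.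
have z0 : 0 <= z by rewrite mulr_ge0 ?expR_ge0.
have zc n : 0 <= exp_coeff z n by rewrite divr_ge0 ?exprn_ge0.
have b i : (J <= i < m)%N -> `|sin_coeff y i| <= expR (- J%:R) * exp_coeff z i.
  move=> /andP[Ji _]; rewrite /sin_coeff /exp_coeff /= !normrM normfV !normr_nat.
  rewrite normrX (normrX i) normrN1 expr1n mulr1 (ger0_norm y0).
  rewrite [leRHS]mulrA ler_wpM2r ?invr_ge0 //.
  apply: (@le_trans _ _ (y ^+ i)).
    by rewrite -[leRHS]mul1r ler_wpM2r ?exprn_ge0 //; case: odd; rewrite ?normr1 ?normr0.
  rewrite exprMn -expRM_natl mulr1 mulrA -expRD -[leLHS]mul1r.
  by rewrite ler_wpM2r ?exprn_ge0 // -[leLHS]expR0 ler_expR addrC subr_ge0 ler_nat.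
rewrite [leRHS](_ : _ = expR (- J%:R) * expR z); last by rewrite -expRD addrC.
rewrite big_seq; apply: (@le_trans _ _ (\sum_(J <= i < m) expR (- J%:R) * exp_coeff z i)).
  rewrite [leRHS]big_seq; apply: ler_sum => i; rewrite mem_index_iota; exact: b.
rewrite -mulr_sumr ler_wpM2l ?expR_ge0 //.
apply: (@le_trans _ _ (series (exp_coeff z) m)).
  by rewrite seriesEnat /= (big_cat_nat (leq0n J) Jm) //= lerDr sumr_ge0.
rewrite /expR; apply: nondecreasing_cvgn_le; last exact: is_cvg_series_exp_coeff.
by apply: nondecreasing_series => n _ _; exact: zc.
Qed.

(** The Taylor polynomial in x of sin(wx), of degree below J: the factor w^i already sits in
    [sin_coeff w i]. *)
Definition sin_poly (R : realType) (w : R) (J : nat) : {poly R} :=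
  \poly_(i < J) sin_coeff w i.

Lemma sin_poly_bound (R : realType) (w x : R) (J : nat) :
  0 <= w -> 0 <= x <= 1 ->
  `|sin (w * x) - (sin_poly R w J).[x]| <= expR (expR 1 * w - J%:R).
Proof.
move=> w0 /andP[x0 x1].
have -> : (sin_poly R w J).[x] = \sum_(i < J) sin_coeff (w * x) i.
  rewrite horner_poly; apply: eq_bigr => i _.
  by rewrite /sin_coeff /= exprMn; ring.
apply: le_trans (sin_taylor_bound _ _ _ _) _; first exact: mulr_ge0.
rewrite ler_expR lerD2r ler_wpM2l ?expR_ge0 //.
by rewrite -[leRHS]mulr1 ler_wpM2l.
Qed.

(** The second error term collects the K Taylor errors, each multiplied by a coefficient and a
    damping factor of modulus at most 1 and bounded by that of the highest frequency. [J] will later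
    be a fixed multiple of [K]. *)
Lemma heat_partial_mlp (R : realType) (alpha : R) (K J : nat) (d : R) :
  0 < d -> 0 < alpha ->
  exists N : mlp R (K + 2) 1,
    mlp_weights N = (2 * K * J * (K + 4) + 1)%N /\
    forall (c : nat -> R) (t x : R), (forall k, `|c k.+1| <= 1) ->
      0 <= t -> 0 <= x <= 1 ->
      `|net_out N c x t - \sum_(1 <= k < K.+1)
          expR (- (4 * pi ^+ 2 * k%:R ^+ 2 * alpha * t)) * c k
            * sin (2 * pi * k%:R * x)|
      <= d + K%:R * expR (expR 1 * (2 * pi * K%:R) - J%:R).
Proof.
move=> d0 al0.
pose w (k : nat) : R := 2 * pi * k.+1%:R.
have w0 k : 0 <= w k by rewrite mulr_ge0 // mulr_ge0 // pi_ge0.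
pose a (k : nat) : R := 4 * pi ^+ 2 * k.+1%:R ^+ 2 * alpha.
have a0 k : 0 <= a k.
  by rewrite mulr_ge0 ?(ltW al0) // !mulr_ge0 ?exprn_ge0 ?pi_ge0.
have pJ k : (size (sin_poly R (w k) J) <= J)%N by exact: size_poly.
have [N [NW NP]] := heat_poly_mlp R K J a _ d d0 a0 pJ.
exists N; split => // c t x c1 t0 x01.
apply: le_trans (ler_distD _ _ _) _; apply: lerD (NP c t x c1 t0 x01) _.
rewrite big_add1 /= big_mkord -sumrB.
apply: le_trans (ler_norm_sum _ _ _) _.
set B := expR _.
apply: (@le_trans _ _ (\sum_(k < K) B)); last first.
  by rewrite sumr_const card_ord mulr_natl.
apply: ler_sum => k _; rewrite -/(a k) -/(w k).
rewrite [X in X * sin _]mulrC -mulrBr !normrM distrC.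
rewrite -[leRHS]mul1r; apply: ler_pM => //.
  rewrite -[leRHS]mulr1; apply: ler_pM => //.
  rewrite ger0_norm ?expR_ge0 // -[leRHS]expR0 ler_expR oppr_le0; exact: mulr_ge0.
apply: le_trans (sin_poly_bound _ _ _ _ (w0 k) x01) _.
rewrite ler_expR lerD2r ler_wpM2l ?expR_ge0 //.
by rewrite ler_wpM2l ?mulr_ge0 ?pi_ge0 // ler_nat.
Qed.

(** * Sine series of Sobolev functions *)

Definition ip01 (R : realType) (f g : R -> R) : R :=
  \int[lebesgue_measure]_(x in `[0, 1]) (f x * g x).

Lemma continuous_integrable01 (R : realType) (f : R -> R) : continuous f ->
  (@lebesgue_measure R).-integrable `[0, 1] (EFin \o f).
Proof.
move=> cf; apply: continuous_compact_integrable; first exact: segment_compact.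
exact: continuous_subspaceT.
Qed.

Lemma continuous_mul (R : realType) (f g : R -> R) :
  continuous f -> continuous g -> continuous (fun x => f x * g x).
Proof. by move=> cf cg x; exact: (continuousM (cf x) (cg x)). Qed.

Lemma L2norm01E (R : realType) (f : R -> R) : continuous f ->
  L2norm01 f = (Num.sqrt (ip01 R f f))%:E.
Proof.
move=> cf; rewrite /L2norm01 unlock /=.
have -> : (\int[lebesgue_measure]_x (`|((f \_ `[0%R, 1%R]) x)%:E| `^ 2))%E
   = (ip01 R f f)%:E.
  have iff := continuous_integrable01 R _ (continuous_mul R _ _ cf cf).
  rewrite /ip01 /Rintegral fineK; last first.
    by apply: integrable_fin_num => //.
  rewrite [RHS]integral_mkcond; apply: eq_integral => x _.
  rewrite /patch /=; case: ifPn => _; last by rewrite normr0 powR0.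
  by rewrite powR_mulrn ?normr_ge0 // real_normK ?num_real // expr2.
by rewrite poweR_EFin powR12_sqrt // /ip01 Rintegral_ge0 // => x _; rewrite -expr2 sqr_ge0.
Qed.

Lemma L2norm01_triangle (R : realType) (f g : R -> R) :
  measurable_fun (`[0, 1] : set R) f -> measurable_fun (`[0, 1] : set R) g ->
  (L2norm01 (f \+ g)%R <= L2norm01 f + L2norm01 g)%E.
Proof.
move=> mf mg; rewrite /L2norm01.
have -> : (f \+ g)%R \_ `[0, 1] = ((f \_ `[0, 1]) \+ (g \_ `[0, 1]))%R.
  by apply/funext => x; rewrite /patch /=; case: ifP => _; rewrite ?addr0.
apply: minkowski_EFin; rewrite ?ler1n //;
  exact/(measurable_restrictT _ _).1.
Qed.

(** The interval has measure 1, so the integral of the square is at most M^2. *)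
Lemma L2norm01_le_sup (R : realType) (f : R -> R) (M : R) : 0 <= M ->
  measurable_fun (`[0, 1] : set R) f ->
  (forall x, 0 <= x <= 1 -> `|f x| <= M) -> (L2norm01 f <= M%:E)%E.
Proof.
move=> M0 mf fM; rewrite /L2norm01 unlock /=.
apply: (@le_trans _ _ (((M ^+ 2)%:E) `^ (2^-1))%E); last first.
  by rewrite poweR_EFin powR12_sqrt ?sqr_ge0 // sqrtr_sqr ger0_norm.
apply: gt0_ler_poweR => //.
- by rewrite in_itv /= leey andbT; apply: integral_ge0 => x _; rewrite lee_fin powR_ge0.
- by rewrite in_itv /= leey andbT lee_fin sqr_ge0.
have -> : (M ^+ 2)%:E = (\int[@lebesgue_measure R]_(x in `[0%R, 1%R]) (M ^+ 2)%:E)%E.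
  by rewrite integral_cst //= lebesgue_measure_itv /= lte_fin ltr01 oppr0 adde0 mule1.
rewrite [leRHS]integral_mkcond; apply: ge0_le_integral => //=.
- apply/measurable_EFinP; apply: (@measurableT_comp _ _ _ _ _ _ (@powR R ^~ 2)) => //.
  apply: measurableT_comp => //; exact/(measurable_restrictT _ _).1.
- by apply/(measurable_restrictT _ _).1 => //; exact: measurable_cst.
- move=> x _; rewrite /patch; case: ifPn => [|_]; last by rewrite normr0 powR0.
  rewrite inE /= in_itv /= => /fM xM.
  by rewrite lee_fin powR_mulrn ?normr_ge0 // ler_sqr ?nnegrE.
Qed.

(** * Inner product of continuous functions, orthogonal systems and Bessel's inequality *)

Section InnerProduct.
Variable R : realType.
Implicit Types (f g h : R -> R) (k : nat) (th x : R).

Lemma ip01C f g : ip01 R f g = ip01 R g f.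
Proof. by apply: eq_Rintegral => x _; rewrite mulrC. Qed.

Lemma ip01D f g h : continuous f -> continuous g -> continuous h ->
  ip01 R f (fun x => g x + h x) = ip01 R f g + ip01 R f h.
Proof.
move=> cf cg ch; rewrite /ip01 -RintegralD //;
  [|exact/continuous_integrable01/continuous_mul..].
by apply: eq_Rintegral => x _; rewrite mulrDr.
Qed.

Lemma ip01Z f g (a : R) : continuous f -> continuous g ->
  ip01 R f (fun x => a * g x) = a * ip01 R f g.
Proof.
move=> cf cg; rewrite /ip01 -RintegralZl //;
  last exact/continuous_integrable01/continuous_mul.
by apply: eq_Rintegral => x _; rewrite mulrCA.
Qed.

Lemma ip01_ge0 f : 0 <= ip01 R f f.
Proof. by apply: Rintegral_ge0 => x _; rewrite -expr2 sqr_ge0. Qed.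

Lemma continuous_scale f (a : R) : continuous f -> continuous (fun x => a * f x).
Proof. by move=> cf; apply: continuous_mul => // x; exact: cvg_cst. Qed.

Lemma continuous_lincomb (e : nat -> R -> R) (b : nat -> R) (s : seq nat) :
  (forall k, continuous (e k)) -> continuous (fun x => \sum_(k <- s) b k * e k x).
Proof.
move=> ce; apply: continuous_big => [|k _]; first exact: add_continuous.
exact: continuous_scale.
Qed.

Lemma ip01_lincomb f (e : nat -> R -> R) (b : nat -> R) (s : seq nat) :
  continuous f -> (forall k, continuous (e k)) ->
  ip01 R f (fun x => \sum_(k <- s) b k * e k x) = \sum_(k <- s) b k * ip01 R f (e k).
Proof.
move=> cf ce; elim: s => [|k s IH].
  rewrite big_nil /ip01; under eq_Rintegral do rewrite big_nil mulr0.
  by rewrite Rintegral_cst // mul0r.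
rewrite big_cons -IH -ip01Z // -ip01D //.
- by apply: eq_Rintegral => x _; rewrite big_cons.
- exact: continuous_scale.
- exact: continuous_lincomb.
Qed.

Section Orthogonal.
Variable e : nat -> R -> R.
Hypothesis ce : forall k, continuous (e k).
(** Normalised like the sines, whose squared norm is 1/2. Index 0 is excluded because that member of
    the sine system is constant. *)
Hypothesis orth : forall j k, (0 < j)%N -> (0 < k)%N ->
  ip01 R (e j) (e k) = if j == k then 2^-1 else 0.

Lemma ip01_orth_coef (b : nat -> R) (s : seq nat) k :
  uniq s -> k \in s -> 0%N \notin s ->
  ip01 R (e k) (fun x => \sum_(j <- s) b j * e j x) = b k / 2.
Proof.
move=> us ks s0; rewrite ip01_lincomb // (bigD1_seq k) //= orth ?eqxx; first last.
- by rewrite lt0n; apply: contraNneq s0 => <-.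
- by rewrite lt0n; apply: contraNneq s0 => <-.
rewrite big_seq_cond big1 ?addr0 // => j /andP[js jk].
rewrite orth ?lt0n; first by rewrite eq_sym (negbTE jk) mulr0.
- by apply: contraNneq s0 => <-.
- by apply: contraNneq s0 => <-.
Qed.

Lemma ip01_orth_sq (b : nat -> R) (s : seq nat) :
  uniq s -> 0%N \notin s ->
  ip01 R (fun x => \sum_(j <- s) b j * e j x) (fun x => \sum_(j <- s) b j * e j x)
  = \sum_(j <- s) b j ^+ 2 / 2.
Proof.
move=> us s0; rewrite [LHS]ip01_lincomb //; last exact: continuous_lincomb.
rewrite big_seq [RHS]big_seq; apply: eq_bigr => k ks.
by rewrite ip01C ip01_orth_coef // mulrA expr2.
Qed.

(** Expand the nonnegative squared norm of f minus its projection; the coefficients 2 <f, e_k> carry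
    the factor 2 because the squared norms are 1/2. *)
Lemma ip01_bessel f (s : seq nat) : continuous f -> uniq s -> 0%N \notin s ->
  \sum_(k <- s) 2 * ip01 R f (e k) ^+ 2 <= ip01 R f f.
Proof.
move=> cf us s0.
pose b k := 2 * ip01 R f (e k).
pose g x := \sum_(k <- s) b k * e k x.
have cg : continuous g by exact: continuous_lincomb.
have cNg : continuous (fun x => -1 * g x) by exact: continuous_scale.
have cd : continuous (fun x => f x + -1 * g x).
  by move=> x; exact: (continuousD (cf x) (cNg x)).
have fg : ip01 R f g = \sum_(k <- s) 2 * ip01 R f (e k) ^+ 2.
  by rewrite ip01_lincomb //; apply: eq_bigr => k _; rewrite /b; ring.
have gg : ip01 R g g = \sum_(k <- s) 2 * ip01 R f (e k) ^+ 2.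
  by rewrite ip01_orth_sq //; apply: eq_bigr => k _; rewrite /b; field.
have := ip01_ge0 (fun x => f x + -1 * g x).
rewrite ip01D // ip01Z // ip01C [X in _ + -1 * X]ip01C !ip01D // !ip01Z // [ip01 R g f]ip01C fg gg.
lra.
Qed.

End Orthogonal.
End InnerProduct.

(** The phase [th] keeps the family closed under differentiation, which shifts it by pi / 2; this
    avoids alternating between sines and cosines in repeated integration by parts. *)
Definition sinw (R : realType) (th : R) (k : nat) (x : R) : R :=
  sin (2 * pi * k%:R * x + th).

Lemma is_derive_sin_affine (R : realType) (a b x : R) :
  is_derive x (1 : R) (fun y => sin (a * y + b)) (a * cos (a * x + b)).
Proof.
have d1 : is_derive x (1 : R) (fun y => a * y + b) a.
  have -> : (fun y => a * y + b) = a *: (id : R -> R) + cst b by [].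
  by apply: is_derive_eq; rewrite addr0 /GRing.scale /= mulr1.
rewrite mulrC.
exact: (@is_derive1_comp R sin (fun y => a * y + b) x _ _ (is_derive_sin _) d1).
Qed.

Lemma sinw_is_derive (R : realType) (th : R) (k : nat) (x : R) :
  is_derive x (1 : R) (sinw R th k) (2 * pi * k%:R * sinw R (th + pi / 2) k x).
Proof. by rewrite /sinw addrA sinDpihalf; exact: is_derive_sin_affine. Qed.

Lemma is_derive_continuous (R : realType) (f df : R -> R) :
  (forall x, is_derive x (1 : R) f (df x)) -> continuous f.
Proof.
move=> H x; apply/differentiable_continuous/derivable1_diffP.
by have [] := H x.
Qed.

Lemma sinw_continuous (R : realType) (th : R) (k : nat) : continuous (sinw R th k).
Proof. exact: is_derive_continuous (sinw_is_derive R th k). Qed.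

Lemma ftc01_data (R : realType) (f df : R -> R) :
  (forall x, is_derive x (1 : R) f (df x)) ->
  derivable_oo_LRcontinuous f 0 1 /\ {in `]0, 1[, f^`()%classic =1 df}.
Proof.
move=> H; have cf := is_derive_continuous _ _ _ H; split; first split.
- by move=> x _; have [] := H x.
- exact: cvg_at_right_filter (cf 0).
- exact: cvg_at_left_filter (cf 1).
- by move=> x _; rewrite derive1E; have [_ ->] := H x.
Qed.

(** The antiderivative sin(ax + b) of a cos(ax + b) takes the same value at both ends. *)
Lemma Rintegral_cos_affine (R : realType) (a b : R) : a != 0 ->
  sin (a + b) = sin b ->
  \int[lebesgue_measure]_(x in `[0, 1]) cos (a * x + b) = 0.
Proof.
move=> a0 ab.
pose F x := sin (a * x + b).
have dF x : is_derive x (1 : R) F (a * cos (a * x + b)).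
  exact: is_derive_sin_affine.
have cc : continuous (fun x : R => cos (a * x + b)).
  have -> : (fun x => cos (a * x + b)) = (fun x => sin (a * x + (b + pi / 2))).
    by apply/funext => x; rewrite addrA sinDpihalf.
  exact: is_derive_continuous (is_derive_sin_affine R a _).
have cc' : continuous (fun x : R => a * cos (a * x + b)) by exact: continuous_scale.
have [F1 F2] := ftc01_data _ _ _ dF.
have := continuous_FTC2 (@ltr01 R) (@continuous_subspaceT _ _ _ _ cc') F1 F2.
have -> : F 1 = F 0 by rewrite /F mulr1 mulr0 add0r.
rewrite subee // => I0.
apply: (mulfI a0); rewrite mulr0 -RintegralZl //; last exact: continuous_integrable01.
by rewrite /Rintegral I0.
Qed.

Lemma sin_int_period (R : realType) (n : nat) (b : R) : sin (2 * pi * n%:R + b) = sin b.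
Proof.
rewrite addrC -[RHS](periodicn (@sinD2pi R) n b) -mulrnA mulnC mulrnA.
by congr (sin (_ + _)); rewrite -mulr_natr; ring.
Qed.

Lemma sinw_orth (R : realType) (th : R) (j k : nat) : (0 < j)%N -> (0 < k)%N ->
  ip01 R (sinw R th j) (sinw R th k) = if j == k then 2^-1 else 0.
Proof.
move=> j0 k0.
pose a : R := 2 * pi * j%:R; pose b : R := 2 * pi * k%:R.
have pi0 : 0 < pi :> R by exact: pi_gt0.
have ccos c d : continuous (fun x : R => cos (c * x + d)).
  have -> : (fun x => cos (c * x + d)) = (fun x => sin (c * x + (d + pi / 2))).
    by apply/funext => x; rewrite addrA sinDpihalf.
  exact: is_derive_continuous (is_derive_sin_affine R c _).
have cosc c d : continuous (fun x : R => 2^-1 * cos (c * x + d)).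
  exact: continuous_scale.
(* Product-to-sum: sin u sin v = (cos(u - v) - cos(u + v)) / 2. Both frequencies are multiples of 2
   pi; the sum never vanishes, and the difference vanishes only for j = k. *)
have -> : ip01 R (sinw R th j) (sinw R th k) =
   2^-1 * \int[lebesgue_measure]_(x in `[0, 1]) cos ((a - b) * x + 0)
   - 2^-1 * \int[lebesgue_measure]_(x in `[0, 1]) cos ((a + b) * x + 2 * th).
  rewrite -!RintegralZl //; last 2 first.
  - apply: continuous_integrable01; exact: ccos.
  - apply: continuous_integrable01; exact: ccos.
  rewrite -RintegralB //; [|exact/continuous_integrable01/cosc..].
  apply: eq_Rintegral => x _; rewrite /sinw -/a -/b.
  have -> : (a - b) * x + 0 = (a * x + th) - (b * x + th) by ring.
  have -> : (a + b) * x + 2 * th = (a * x + th) + (b * x + th) by ring.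
  by move: (a * x + th) (b * x + th) => u v; rewrite cosB cosD; field.
rewrite [X in _ - _ * X](Rintegral_cos_affine R (a + b)); first last.
- by rewrite -mulrDr -natrD sin_int_period.
- by rewrite gt_eqF // -mulrDr -natrD mulr_gt0 ?mulr_gt0 // ltr0n addn_gt0 j0.
rewrite mulr0 subr0; case: eqP => [jk|/eqP jk].
  under eq_Rintegral do rewrite /a /b jk subrr mul0r add0r cos0.
  by rewrite Rintegral_cst //= lebesgue_measure_itv /= lte_fin ltr01 oppr0 adde0 !mulr1.
rewrite Rintegral_cos_affine ?mulr0 //.
  rewrite -mulrBr; apply: mulf_neq0; last by rewrite subr_eq0 eqr_nat.
  by rewrite mulf_neq0 ?gt_eqF.
rewrite addr0 sin0 sinB -[a]addr0 -[b]addr0 !sin_int_period sin0.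
by rewrite mul0r mulr0 subrr.
Qed.

Lemma ip01_by_parts (R : realType) (f df : R -> R) (th : R) (k : nat) :
  (forall x, is_derive x (1 : R) f (df x)) -> continuous df -> f 0 = 0 -> f 1 = 0 ->
  ip01 R df (sinw R th k) = - (2 * pi * k%:R) * ip01 R f (sinw R (th + pi / 2) k).
Proof.
move=> Hf cdf f0 f1.
have [F1 F2] := ftc01_data _ _ _ Hf.
have [G1 G2] := ftc01_data _ _ _ (sinw_is_derive R th k).
have cG : continuous (fun x => 2 * pi * k%:R * sinw R (th + pi / 2) k x).
  exact/continuous_scale/sinw_continuous.
have := Rintegration_by_parts (@ltr01 R) (@continuous_subspaceT _ _ _ _ cG) G1 G2
  (@continuous_subspaceT _ _ _ _ cdf) F1 F2.
rewrite f0 f1 !mulr0 subrr sub0r ip01C /ip01 => ->.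
rewrite mulNr -RintegralZl //; last first.
  apply/continuous_integrable01/continuous_mul; last exact: sinw_continuous.
  exact: is_derive_continuous Hf.
by congr (- _); apply: eq_Rintegral => x _; ring.
Qed.

Lemma derive1n_eq0 (R : realType) (phi : R -> R) (a b : R) (j : nat) :
  (forall x, x \notin `[a, b] -> phi x = 0) ->
  forall x, x \notin `[a, b] -> derive1n j phi x = 0.
Proof.
move=> phi0; elim: j => [|j IH] x xab; first exact: phi0.
rewrite derive1nS derive1E.
rewrite (@near_eq_derive _ _ _ _ (cst 0)) ?derive_cst //.
have oU : open (~` (`[a, b] : set R)) by rewrite openC; exact: itv_closed.
have xU : (~` (`[a, b] : set R)) x by move=> /= xin; rewrite xin in xab.
apply: filterS (open_nbhs_nbhs (conj oU xU)) => y /= yab.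
by apply: IH; apply/negP.
Qed.

(** The support lies strictly inside (0, 1), so every derivative vanishes at the endpoints; these
    are the boundary terms of the integrations by parts. *)
Lemma C0r_derive1n (R : realType) (r : nat) (phi : R -> R) (j : nat) :
  C0r r phi -> (j <= r)%N ->
  [/\ continuous (derive1n j phi), derive1n j phi 0 = 0, derive1n j phi 1 = 0 &
      (j < r)%N ->
      forall x, is_derive x (1 : R) (derive1n j phi) (derive1n j.+1 phi x)].
Proof.
move=> [[dphi cphi] [a [b [a0 b1 phi0]]]] jr; split.
- move: jr; rewrite leq_eqVlt => /predU1P[->//|jr] x.
  exact/differentiable_continuous/derivable1_diffP/dphi.
- by apply: derive1n_eq0 phi0 _ _; rewrite in_itv /= leNgt a0.
- by apply: derive1n_eq0 phi0 _ _; rewrite in_itv /= [1 <= b]leNgt b1 andbF.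
- by move=> ltjr x; apply: DeriveDef; [exact: dphi|rewrite derive1nS derive1E].
Qed.

Lemma ip01_derive1n (R : realType) (r : nat) (phi : R -> R) (j k : nat) (th : R) :
  C0r r phi -> (j <= r)%N ->
  ip01 R (derive1n j phi) (sinw R th k)
  = (- (2 * pi * k%:R)) ^+ j * ip01 R phi (sinw R (th + j%:R * (pi / 2)) k).
Proof.
move=> Cphi; elim: j th => [|j IH] th jr; first by rewrite mul0r addr0 mul1r.
have [_ f0 f1 /(_ jr) df] := C0r_derive1n _ _ _ _ Cphi (ltnW jr).
have [cdf _ _ _] := C0r_derive1n _ _ _ _ Cphi jr.
rewrite (ip01_by_parts _ _ _ _ _ df cdf f0 f1) (IH _ (ltnW jr)) exprS mulrA.
by congr (_ * ip01 R phi (sinw R _ k)); rewrite -natr1; ring.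
Qed.

Lemma sqrt_ip01_le (R : realType) (h f g : R -> R) :
  continuous h -> h = (f \+ g)%R ->
  measurable_fun (`[0, 1] : set R) f -> measurable_fun (`[0, 1] : set R) g ->
  L2norm01 f \is a fin_num -> L2norm01 g \is a fin_num ->
  Num.sqrt (ip01 R h h) <= fine (L2norm01 f) + fine (L2norm01 g).
Proof.
move=> ch hE mf mg ff gf.
rewrite -lee_fin -L2norm01E // EFinD !fineK // hE.
exact: L2norm01_triangle.
Qed.

Lemma L2norm01_distC (R : realType) (f g : R -> R) :
  L2norm01 (f \- g)%R = L2norm01 (g \- f)%R.
Proof.
rewrite /L2norm01 -oppe_Lnorm; apply: eq_Lnorm => x /=.
by rewrite /patch /=; case: ifP => _; rewrite ?oppr0 ?opprB.
Qed.

Lemma measurable_continuous01 (R : realType) (f : R -> R) :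
  continuous f -> measurable_fun (`[0, 1] : set R) f.
Proof.
by move=> cf; apply: measurable_funTS; exact: continuous_measurable_fun.
Qed.

Lemma sine_partialE (R : realType) (c : nat -> R) (n : nat) :
  sine_partial c n = fun x => \sum_(k <- index_iota 1 n.+1) c k * sinw R 0 k x.
Proof.
by apply/funext => x; apply: eq_bigr => k _; rewrite /sinw addr0.
Qed.

Lemma sine_partial_continuous (R : realType) (c : nat -> R) (n : nat) :
  continuous (sine_partial c n).
Proof. by rewrite sine_partialE; apply: continuous_lincomb => k; exact: sinw_continuous. Qed.

(** All inner products are taken on the continuous approximants phi_n, since f and g are only
    measurable. Bessel for phi_n^(r), moved onto phi_n by r integrations by parts, bounds a finite
    weighted sum by the squared norm of phi_n^(r); letting n tend to infinity replaces the
    coefficients of phi_n by c_k / 2. *)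
Lemma sobolev_sine_coef_bound (R : realType) (r : nat) (f g : R -> R) (c : nat -> R) :
  (fun n => L2norm01 (sine_partial c n \- f)) @ \oo --> 0%E ->
  sobolev2 r f g -> (L2norm01 g <= 1%:E)%E ->
  forall N, \sum_(0 <= k < N) ((2 * pi * k.+1%:R) ^+ r * c k.+1) ^+ 2 / 2 <= 1.
Proof.
move=> Scvg [phi [gs [Cphi mgs phicvg gs0 gsr]]] g1 N.
have mf : measurable_fun (`[0, 1] : set R) f by rewrite -gs0; exact: mgs.
have mg : measurable_fun (`[0, 1] : set R) g by rewrite -gsr; exact: mgs.
have cphi n : continuous (phi n) by have [] := C0r_derive1n _ _ _ _ (Cphi n) (leq0n r).
have cphir n : continuous (derive1n r (phi n)).
  by have [] := C0r_derive1n _ _ _ _ (Cphi n) (leqnn r).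
have [/= fS cS] := (fine_cvgP _ _).1 Scvg.
have phi0cvg : (fun n => L2norm01 (phi n \- f)) @ \oo --> 0%E.
  by have := phicvg 0%N (leq0n r); rewrite gs0.
have [/= fP cP] := (fine_cvgP _ _).1 phi0cvg.
have phircvg : (fun n => L2norm01 (derive1n r (phi n) \- g)) @ \oo --> 0%E.
  by have := phicvg r (leqnn r); rewrite gsr.
have [/= fQ cQ] := (fine_cvgP _ _).1 phircvg.
have gfin : L2norm01 g \is a fin_num.
  by rewrite ge0_fin_numE ?Lnorm_ge0 //; apply: le_lt_trans g1 _; rewrite ltry.
have g1' : fine (L2norm01 g) <= 1 by rewrite -lee_fin fineK.
have msub (u v : R -> R) : measurable_fun (`[0, 1] : set R) u ->
    measurable_fun (`[0, 1] : set R) v -> measurable_fun (`[0, 1] : set R) (u \- v).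
  by move=> mu mv; exact: measurable_funB.
have cphiS n : continuous (phi n \- sine_partial c n).
  by move=> x; apply: continuousB; [exact: cphi|exact: sine_partial_continuous].
(* Both phi_n and the n-th sine partial sum tend to f in L_2, so their difference tends to 0; for n
   >= k the partial sum pairs with the k-th sine to exactly c_k / 2. *)
have coefcvg k : (0 < k)%N ->
    (fun n => ip01 R (phi n) (sinw R 0 k)) @ \oo --> c k / 2.
  move=> k0.
  pose d n := fine (L2norm01 (phi n \- f)) + fine (L2norm01 (sine_partial c n \- f)).
  have dcvg : d @ \oo --> 0 by rewrite -[X in _ --> X]addr0; exact: cvgD.
  have near_d : \forall n \near \oo, `|ip01 R (phi n) (sinw R 0 k) - c k / 2| <= d n.
    near=> n.
    have nk : (k <= n)%N by near: n; exists k.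
    have cs := sinw_continuous R 0 k.
    have csp := sine_partial_continuous R c n.
    have -> : ip01 R (phi n) (sinw R 0 k) - c k / 2
        = ip01 R (phi n \- sine_partial c n) (sinw R 0 k).
      rewrite -(ip01_orth_coef R (sinw R 0) (sinw_continuous R 0) (sinw_orth R 0) c
        (index_iota 1 n.+1)) ?iota_uniq ?mem_index_iota //; last by rewrite k0.
      rewrite -sine_partialE ip01C [RHS]ip01C /ip01 -RintegralB //;
        [|exact/continuous_integrable01/continuous_mul..].
      by apply: eq_Rintegral => x _ /=; rewrite mulrBr.
    (* Bessel for a single index plays the role of the Cauchy-Schwarz inequality. *)
    have B := ip01_bessel R (sinw R 0) (sinw_continuous R 0) (sinw_orth R 0) _
       [:: k] (cphiS n) isT.
    have {}B := B _; rewrite big_seq1 in B.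
    set a := ip01 R _ _ in B *.
    have {}B : 2 * a ^+ 2 <= ip01 R (phi n \- sine_partial c n) (phi n \- sine_partial c n).
      by apply: B; rewrite inE eq_sym -lt0n.
    apply: (@le_trans _ _ (Num.sqrt
      (ip01 R (phi n \- sine_partial c n) (phi n \- sine_partial c n)))).
      rewrite -sqrtr_sqr ler_sqrt ?ip01_ge0 //; apply: le_trans B.
      by have := sqr_ge0 a; lra.
    rewrite /d [X in _ + fine X]L2norm01_distC.
    apply: sqrt_ip01_le => //.
    - by apply/funext => x /=; ring.
    - apply: msub => //; exact: measurable_continuous01.
    - apply: msub => //; exact: measurable_continuous01.
    - by near: n; exact: fP.
    - by rewrite L2norm01_distC; near: n; exact: fS.
  apply: (@squeeze_cvgr _ _ _ _ (fun n => c k / 2 - d n) (fun n => c k / 2 + d n)).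
  - apply: filterS near_d => n; rewrite ler_norml => /andP[? ?]; apply/andP; split; lra.
  - by rewrite -[X in _ --> X]subr0; apply: cvgB => //; exact: cvg_cst.
  - by rewrite -[X in _ --> X]addr0; apply: cvgD => //; exact: cvg_cst.
pose w k : R := (2 * pi * k.+1%:R) ^+ r.
have Acvg : (fun n => \sum_(k <- index_iota 0 N)
      2 * (w k * ip01 R (phi n) (sinw R 0 k.+1)) ^+ 2) @ \oo -->
    \sum_(k <- index_iota 0 N) 2 * (w k * (c k.+1 / 2)) ^+ 2.
  apply: cvg_big => [|k _]; first exact: add_continuous.
  apply: cvgM; first exact: cvg_cst.
  have wc : (fun n => w k * ip01 R (phi n) (sinw R 0 k.+1)) @ \oo --> w k * (c k.+1 / 2).
    by apply: cvgM; [exact: cvg_cst|exact: coefcvg].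
  by under eq_fun do rewrite expr2; rewrite expr2; exact: cvgM.
pose v n := fine (L2norm01 (derive1n r (phi n) \- g)) + 1.
have vcvg : (fun n => v n ^+ 2) @ \oo --> (1 : R).
  have v1 : v @ \oo --> (1 : R).
    by rewrite -[X in _ --> X]add0r; apply: cvgD => //; exact: cvg_cst.
  by rewrite -[X in _ --> X]mulr1; under eq_fun do rewrite expr2; exact: cvgM.
have -> : \sum_(0 <= k < N) ((2 * pi * k.+1%:R) ^+ r * c k.+1) ^+ 2 / 2
    = \sum_(k <- index_iota 0 N) 2 * (w k * (c k.+1 / 2)) ^+ 2.
  by apply: eq_bigr => k _; rewrite -/(w k); field.
apply: (ler_cvg_to Acvg vcvg); near=> n.
(* Starting from this phase, r integrations by parts end at phase 0, that is, at the sines of the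
   expansion. *)
pose th : R := - (r%:R * (pi / 2)).
have -> : \sum_(k <- index_iota 0 N) 2 * (w k * ip01 R (phi n) (sinw R 0 k.+1)) ^+ 2
   = \sum_(k <- index_iota 1 N.+1) 2 * ip01 R (derive1n r (phi n)) (sinw R th k) ^+ 2.
  rewrite big_add1 /=; apply: eq_bigr => k _.
  rewrite (ip01_derive1n R r (phi n) r _ th (Cphi n) (leqnn r)) /th addNr /w.
  by rewrite exprNn [in RHS]exprMn [in RHS]exprMn sqrr_sign mul1r -exprMn.
apply: le_trans (ip01_bessel R (sinw R th) (sinw_continuous R th) (sinw_orth R th) _ _
  (cphir n) _ _) _; rewrite ?iota_uniq ?mem_index_iota //.
rewrite -[leLHS]sqr_sqrtr ?ip01_ge0 // ler_sqr ?nnegrE ?sqrtr_ge0 //; last first.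
  by rewrite addr_ge0 // fine_ge0 ?Lnorm_ge0.
apply: le_trans (sqrt_ip01_le R _ (derive1n r (phi n) \- g) g _ _ _ _ _ _) _ => //.
- by apply/funext => x /=; rewrite subrK.
- apply: msub => //; exact: measurable_continuous01.
- by near: n; exact: fQ.
- by rewrite lerD2l.
Unshelve. all: by end_near.
Qed.

(** * The heat semigroup *)

Lemma tanh_continuous (R : realType) : continuous (@tanh R).
Proof.
move=> x; have eN : {for x, continuous (fun y : R => expR (- y))}.
  apply: (@continuous_comp _ _ _ -%R expR); first exact: opp_continuous.
  exact: continuous_expR.
have e := @continuous_expR R x.
apply: (@continuousM _ _ (fun y => expR y - expR (- y))
  (fun y => (expR y + expR (- y))^-1) x); first exact: continuousB e eN.
apply: (@continuousV _ _ (fun y => expR y + expR (- y)) x); last exact: continuousD e eN.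
by rewrite gt_eqF // addr_gt0 ?expR_gt0.
Qed.

(** Makes the network output measurable in x, as the L_2 estimates of the error require. *)
Lemma mlp_eval_continuous (R : realType) (m p : nat) (N : mlp R m p)
    (v : R -> 'cV[R]_m) :
  (forall i, continuous (fun x => v x i ord0)) ->
  forall i, continuous (fun x => mlp_eval N (v x) i ord0).
Proof.
elim: N v => [//|{}m n {}p M b act rest IH] v cv.
apply: (IH (fun x => if act then _ else _)) => i.
pose l x := \sum_(j < m) M i j * v x j ord0 + (if b is Some b' then b' i ord0 else 0).
have cl : continuous l.
  move=> x; apply: (@continuousD _ _ _ (fun x => \sum_(j < m) M i j * v x j ord0)
    (fun=> if b is Some b' then b' i ord0 else 0) x); last exact: cst_continuous.
  by apply: continuous_big => [|j _]; [exact: add_continuous|exact/continuous_scale/cv].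
have lE x : (M *m v x + (if b is Some b' then b' else 0)) i ord0 = l x.
  by rewrite !mxE /l; case: b {l cl} => [b'|]; rewrite ?mxE.
case: act => /=.
  under [X in continuous X]eq_fun do rewrite mxE lE.
  by move=> x; apply: (@continuous_comp _ _ _ l (@tanh R) x (cl x)); exact: tanh_continuous.
by under [X in continuous X]eq_fun do rewrite lE.
Qed.

Lemma net_out_continuous (R : realType) (K : nat) (N : mlp R (K + 2) 1)
    (c : nat -> R) (t : R) : continuous (fun x => net_out N c x t).
Proof.
apply: mlp_eval_continuous => i.
under [X in continuous X]eq_fun do rewrite mxE.
case: (i < K)%N; first by move=> x; exact: cst_continuous.
case: (i == K :> nat) => x; first exact: cst_continuous.
exact: cvg_id.
Qed.

(** * Decay of the coefficients and convergence of the heat series *)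

Section Tail.
Variables (R : realType) (r : nat) (c : nat -> R).
Hypothesis r0 : (0 < r)%N.
Hypothesis cr : forall N,
  \sum_(0 <= k < N) ((2 * pi * k.+1%:R) ^+ r * c k.+1) ^+ 2 / 2 <= 1.

Lemma pi_ge1 : 1 <= pi :> R.
Proof. by apply: le_trans (pi_ge2 R); rewrite ler1n. Qed.

(** Since r >= 1, one has 2^r >= 2; this factor 2 is what leaves half of the error budget free after
    truncation. *)
Lemma weight_ge (K k : nat) : (K <= k.+1)%N ->
  2 * K%:R ^+ r <= (2 * pi * k.+1%:R) ^+ r :> R.
Proof.
move=> Kk; apply: (@le_trans _ _ ((2 * K%:R) ^+ r)).
  rewrite exprMn ler_wpM2r ?exprn_ge0 //.
  by rewrite -[leLHS]expr1 ler_weXn2l // ler1n.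
rewrite lerXn2r ?nnegrE ?mulr_ge0 ?pi_ge0 //.
rewrite ler_pM //; last by rewrite ler_nat.
by have := pi_ge1; lra.
Qed.

Lemma coef_le1 k : `|c k.+1| <= 1.
Proof.
have := cr k.+1; rewrite big_nat_recr //=.
set s := \sum_(_ <= _ < _) _ => h.
have s0 : 0 <= s by apply: sumr_ge0 => i _; rewrite divr_ge0 ?sqr_ge0.
have w2 := weight_ge 1 k isT; rewrite expr1n mulr1 in w2.
rewrite -(@expr_le1 _ 2) // real_normK ?num_real //.
move: h; set w := (_ ^+ r) in w2 *; rewrite exprMn => h.
have c0 := sqr_ge0 (c k.+1).
have w4 : 4 <= w ^+ 2 by nra.
nra.
Qed.

Lemma coef_tail_sq (K N : nat) : (0 < K)%N ->
  \sum_(K <= k < N) c k.+1 ^+ 2 / 2 <= ((2 * K%:R ^+ r)^-1) ^+ 2.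
Proof.
move=> K0; have W0 : 0 < 2 * K%:R ^+ r :> R by rewrite mulr_gt0 ?exprn_gt0 ?ltr0n.
rewrite exprVn -[leRHS]mul1r ler_pdivlMr ?exprn_gt0 // mulr_suml.
have [NK|KN] := leqP N K; first by rewrite big_geq.
have := cr N; rewrite (big_cat_nat (leq0n K) (ltnW KN)) /= => h.
apply: le_trans h; apply: ler_wpDl; first by apply: sumr_ge0 => i _; rewrite divr_ge0 ?sqr_ge0.
rewrite big_nat [leRHS]big_nat; apply: ler_sum => k /andP[Kk _].
rewrite mulrAC ler_pM2r ?invr_gt0 // [leRHS]exprMn mulrC ler_wpM2r ?sqr_ge0 //.
have W1 : 0 <= (2 * pi * k.+1%:R) ^+ r :> R by rewrite exprn_ge0 // !mulr_ge0 ?pi_ge0.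
by rewrite ler_sqr ?nnegrE ?(ltW W0) // weight_ge // (leq_trans Kk).
Qed.

(** Telescoping: 1 / (y + 1)^2 <= 1 / y - 1 / (y + 1), with difference 1 / (y (y + 1)^2). *)
Lemma sum_inv_sq (N : nat) :
  \sum_(0 <= k < N.+1) (k.+1%:R ^+ 2)^-1 <= 2 - (N.+1%:R)^-1 :> R.
Proof.
elim: N => [|N IH]; first by rewrite big_nat1 expr1n invr1; lra.
rewrite big_nat_recr //=; apply: le_trans (lerD IH (lexx _)) _.
have h : 0 < N.+1%:R :> R by rewrite ltr0n.
rewrite -[N.+2%:R]natr1; move: h; move: (N.+1%:R) => y h.
have y10 : 0 < y + 1 by lra.
rewrite -subr_ge0.
have -> : 2 - (y + 1)^-1 - (2 - y^-1 + ((y + 1) ^+ 2)^-1) = (y * (y + 1) ^+ 2)^-1.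
  by field; rewrite !gt_eqF.
by rewrite invr_ge0 mulr_ge0 ?exprn_ge0 // ltW.
Qed.

(** With w = (2 pi k)^r >= k, the inequality ab <= (a^2 + b^2) / 2 gives |c_k| <= |w c_k| (1 / k) <=
    (w c_k)^2 / 2 + 1 / (2 k^2); the two sums are each at most 1. The resulting absolute convergence
    holds down to t = 0. *)
Lemma coef_abs_sum (N : nat) : \sum_(0 <= k < N) `|c k.+1| <= 2.
Proof.
apply: (@le_trans _ _ (\sum_(0 <= k < N)
   (((2 * pi * k.+1%:R) ^+ r * c k.+1) ^+ 2 / 2 + (k.+1%:R ^+ 2)^-1 / 2))).
  rewrite !big_mkord; apply: ler_sum => k _.
  set w := _ ^+ r; set y : R := k.+1%:R.
  have y1 : 1 <= y by rewrite ler1n.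
  have wy : y <= w.
    have : 2 * y ^+ r <= w by exact: weight_ge.
    have : y ^+ 1 <= y ^+ r by rewrite ler_weXn2l.
    by rewrite expr1; lra.
  have yV : y * y^-1 = 1 by rewrite divff // gt_eqF //; lra.
  rewrite -exprVn.
  have cw : y * `|c k.+1| <= `|w * c k.+1|.
    by rewrite normrM ler_wpM2r // ger0_norm //; lra.
  rewrite -[(w * _) ^+ 2]real_normK ?num_real //.
  have -> : `|c k.+1| = (y * `|c k.+1|) * y^-1 by rewrite mulrAC yV mul1r.
  have V0 : 0 <= y^-1 by rewrite invr_ge0; lra.
  apply: le_trans (ler_wpM2r V0 cw) _.
  have := sqr_ge0 (`|w * c k.+1| - y^-1); rewrite sqrrB.
  by move: (y^-1) `|w * c k.+1| => V X; lra.
rewrite big_split /= -[X in _ + X]mulr_suml.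
have h1 := cr N; have := sum_inv_sq N; rewrite big_nat_recr //=.
have h3 : 0 <= (N.+1%:R ^+ 2)^-1 :> R by rewrite invr_ge0 exprn_ge0.
have h4 : 0 <= (N.+1%:R)^-1 :> R by rewrite invr_ge0.
move: h1 h3 h4.
set a := (\sum_(_ <= _ < _) _); set b := (\sum_(_ <= _ < _) _).
move: (_ ^-1) (N.+1%:R^-1) => p q; lra.
Qed.

Section Heat.
Variables (alpha t : R).
Hypothesis alpha0 : 0 <= alpha.
Hypothesis t0 : 0 <= t.

Let damp (k : nat) : R := expR (- (4 * pi ^+ 2 * k%:R ^+ 2 * alpha * t)).

Let heat_partial (N : nat) (x : R) : R :=
  \sum_(1 <= k < N.+1) damp k * c k * sin (2 * pi * k%:R * x).

Lemma damp_itv k : 0 <= damp k <= 1.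
Proof.
rewrite expR_ge0 -[leRHS]expR0 ler_expR oppr_le0.
by rewrite !mulr_ge0 ?exprn_ge0 ?pi_ge0.
Qed.

Lemma heat_partialE N :
  heat_partial N = fun x => \sum_(k <- index_iota 1 N.+1) (damp k * c k) * sinw R 0 k x.
Proof. by apply/funext => x; apply: eq_bigr => k _; rewrite /sinw addr0. Qed.

Lemma heat_partial_continuous N : continuous (heat_partial N).
Proof.
by rewrite heat_partialE; apply: continuous_lincomb => k; exact: sinw_continuous.
Qed.

Let term (x : R) (k : nat) : R := damp k.+1 * c k.+1 * sin (2 * pi * k.+1%:R * x).

Lemma heat_partial_series N x : heat_partial N x = series (term x) N.
Proof. by rewrite /heat_partial big_add1 seriesEnat. Qed.

Lemma term_le x k : `|term x k| <= `|c k.+1|.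
Proof.
have /andP[d0 d1] := damp_itv k.+1.
rewrite !normrM (ger0_norm d0) -[leRHS]mulr1 ler_pM ?mulr_ge0 ?sin_max //.
by rewrite -[leRHS]mul1r ler_wpM2r.
Qed.

Lemma abs_coef_cvg : cvgn (series (fun k => `|c k.+1|)).
Proof.
apply: nondecreasing_is_cvgn; first by apply: nondecreasing_series.
exists 2 => _ [N _ <-]; rewrite seriesEnat; exact: coef_abs_sum.
Qed.

(** Shows that the [limn] in [heat_sol] is a genuine limit and not a default value. *)
Lemma heat_partial_cvg x : heat_partial ^~ x @ \oo --> heat_sol alpha c x t.
Proof.
have -> : heat_partial ^~ x = series (term x).
  by apply/funext => N; exact: heat_partial_series.
have -> : heat_sol alpha c x t = limn (series (term x)).
  by rewrite /heat_sol; congr (lim (_ @ \oo)); apply/funext => N; exact: heat_partial_series.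
apply: normed_cvg; apply: series_le_cvg abs_coef_cvg => [k|//|k]; [exact: normr_ge0|exact: term_le].
Qed.

(** Weierstrass M-test with majorant |c_k|. Having N >= K lets the L_2 tail estimate apply between K
    and N. *)
Lemma heat_partial_unif (e : R) (K : nat) : 0 < e -> exists2 N, (K <= N)%N &
  forall x, `|heat_sol alpha c x t - heat_partial N x| <= e.
Proof.
move=> e0; pose S := series (fun k => `|c k.+1|).
have Scvg : S @ \oo --> limn S by exact: abs_coef_cvg.
have Snd : {homo S : n m / (n <= m)%N >-> n <= m} by exact: nondecreasing_series.
have [N0 _ HN0] := (cvgrPdist_le _ _).1 Scvg _ e0.
pose N := maxn K N0; exists N; first exact: leq_maxl.
move=> x; apply: (@cvg_dist_le _ _ _ _ _ N (heat_partial_cvg x)) => M NM.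
have SN : limn S - S N <= e.
  by apply: le_trans (ler_norm _) _; apply: HN0; rewrite /= leq_maxr.
apply: le_trans SN.
apply: (@le_trans _ _ (S M - S N)); last first.
  by rewrite lerD2r; exact: nondecreasing_cvgn_le.
rewrite !heat_partial_series /S !seriesEnat /= !(big_cat_nat (leq0n N) NM) /=.
rewrite addrAC subrr add0r [leRHS]addrAC subrr add0r.
apply: le_trans (ler_norm_sum _ _ _) _; apply: ler_sum => k _; exact: term_le.
Qed.

Lemma heat_partial_tail (K N : nat) : (0 < K <= N)%N ->
  (L2norm01 (heat_partial N \- heat_partial K)%R <= (2 * K%:R ^+ r)^-1%:E)%E.
Proof.
move=> /andP[K0 KN].
have -> : (heat_partial N \- heat_partial K)%R =
   fun x => \sum_(k <- index_iota K.+1 N.+1) (damp k * c k) * sinw R 0 k x.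
  apply/funext => x /=; rewrite !heat_partialE.
  rewrite (big_cat_nat (isT : (1 <= K.+1)%N) (KN : (K.+1 <= N.+1)%N)) /=.
  by rewrite addrAC subrr add0r.
rewrite L2norm01E; last by apply: continuous_lincomb => k; exact: sinw_continuous.
rewrite (ip01_orth_sq R (sinw R 0) (sinw_continuous R 0) (sinw_orth R 0));
  [|exact: iota_uniq|by rewrite mem_index_iota].
rewrite lee_fin.
have V0 : 0 <= (2 * K%:R ^+ r)^-1 :> R by rewrite invr_ge0 mulr_ge0 ?exprn_ge0.
rewrite -[leRHS](ger0_norm V0) -sqrtr_sqr ler_sqrt ?sqr_ge0 //.
apply: le_trans (coef_tail_sq K N K0); rewrite big_add1 /=.
apply: ler_sum => k _; have /andP[d0 d1] := damp_itv k.+1.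
rewrite ler_pM2r ?invr_gt0 // exprMn -[leRHS]mul1r ler_wpM2r ?sqr_ge0 //.
by rewrite expr_le1.
Qed.

(** An intermediate level N splits the error: modes K + 1 to N by orthogonality in L_2, modes beyond
    N and the distance from F to the K-th partial sum in sup norm. No infinite sum is exchanged with
    an integral. *)
Lemma heat_L2_error (F : R -> R) (K : nat) (d e : R) : (0 < K)%N -> 0 < e -> 0 <= d ->
  continuous F ->
  (forall x, 0 <= x <= 1 -> `|F x - heat_partial K x| <= d) ->
  (L2norm01 (fun x => (heat_sol alpha c x t - F x)%R)
    <= ((2 * K%:R ^+ r)^-1 + (e + d))%:E)%E.
Proof.
move=> K0 e0 d0 cF Fd.
have [N KN HN] := heat_partial_unif e K e0.
pose g x := (heat_sol alpha c x t - heat_partial N x) + (heat_partial K x - F x).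
have -> : (fun x => heat_sol alpha c x t - F x)
    = ((heat_partial N \- heat_partial K) \+ g)%R.
  by apply/funext => x /=; rewrite /g; ring.
have mh n : measurable_fun (`[0, 1] : set R) (heat_partial n).
  apply: measurable_continuous01; exact: heat_partial_continuous.
have mu : measurable_fun (`[0, 1] : set R) (fun x => heat_sol alpha c x t).
  by apply: (measurable_fun_cvg mh) => x _; exact: heat_partial_cvg.
have mg : measurable_fun (`[0, 1] : set R) g.
  apply: measurable_funD; apply: measurable_funB => //.
  exact: measurable_continuous01.
apply: le_trans (L2norm01_triangle _ _ _ _ mg) _; first exact: measurable_funB.
rewrite EFinD; apply: leeD; first by apply: heat_partial_tail; rewrite K0.
apply: L2norm01_le_sup => //; first by rewrite addr_ge0 // ltW.
move=> x x01; apply: le_trans (ler_normD _ _) _.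
by apply: lerD; [exact: HN|rewrite distrC; exact: Fd].
Qed.

End Heat.
End Tail.

(** * Choice of the parameters and conclusion *)

Lemma truncation_level (R : realType) (r : nat) (eps : R) : (0 < r)%N -> 0 < eps < 1 ->
  exists K : nat, [/\ (0 < K)%N, eps `^ (- r%:R^-1) <= K%:R,
    K%:R <= 2 * eps `^ (- r%:R^-1) & 1 <= eps * K%:R ^+ r].
Proof.
move=> r0 /andP[e0 e1]; set P := eps `^ (- r%:R^-1).
have Pr : P ^+ r = eps^-1.
  rewrite -powR_mulrn ?powR_ge0 // -powRrM mulNr mulVf ?pnatr_eq0 -?lt0n //.
  by rewrite powR_inv1 // ltW.
have P0 : 0 <= P by exact: powR_ge0.
have P1 : 1 <= P.
  by rewrite -(@expr_ge1 _ r) // Pr invf_ge1 // ltW.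
have /andP[t1 t2] := truncn_itv P0.
(* With P = eps^{-1/r} >= 1, this integer lies between P and P + 1 <= 2P, and P^r = 1 / eps. *)
exists (Num.truncn P).+1; split => //.
- exact: ltW.
- by rewrite -natr1 mulr_natl mulr2n; exact: lerD.
- rewrite -(@ler_pM2l _ eps^-1) ?invr_gt0 // mulrA mulVf ?gt_eqF // mulr1 mul1r -Pr.
  by rewrite lerXn2r ?nnegrE // ltW.
Qed.

(** Each factor is dominated by an exponential in K: 8 by e^{8K}, K^r by e^{rK}, K by e^K. The
    exponents add up to K (2 pi e + r + 9 - A) <= 0. *)
Lemma taylor_exponent (R : realType) (r A K : nat) :
  (0 < K)%N -> expR 1 * (2 * pi) + r%:R + 9 <= A%:R :> R ->
  8 * K%:R ^+ r * (K%:R * expR (expR 1 * (2 * pi * K%:R) - (A * K)%:R)) <= 1 :> R.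
Proof.
move=> K0 hA; set k : R := K%:R.
have k1 : 1 <= k by rewrite ler1n.
have ek : k <= expR k by have := expR_ge1Dx k; lra.
have e8 : 8 <= expR (8 * k).
  by have := expR_ge1Dx (8 * k); lra.
have er : k ^+ r <= expR (r%:R * k).
  by rewrite expRM_natl lerXn2r ?nnegrE ?expR_ge0 //; lra.
apply: (@le_trans _ _ (expR (8 * k) * expR (r%:R * k) *
  (expR k * expR (expR 1 * (2 * pi * k) - (A * K)%:R)))).
  apply: ler_pM.
  - by rewrite mulr_ge0 ?exprn_ge0 //; lra.
  - by rewrite mulr_ge0 ?expR_ge0 //; lra.
  - by apply: ler_pM => //; rewrite exprn_ge0 //; lra.
  - by rewrite ler_wpM2r ?expR_ge0.
rewrite -!expRD -[leRHS]expR0 ler_expR natrM -/k.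
have -> : 8 * k + r%:R * k + (k + (expR 1 * (2 * pi * k) - A%:R * k))
  = k * (expR 1 * (2 * pi) + r%:R + 9 - A%:R) by ring.
by rewrite mulr_ge0_le0 //; lra.
Qed.

Theorem theorem4 (R : realType) (alpha : R) (r : nat) :
  0 < alpha -> (0 < r)%N ->
  exists C c : R, 0 < C /\ 0 < c /\
  forall eps : R, 0 < eps < 1 ->
  exists (K : nat) (N : mlp R (K + 2) 1),
    [/\ c * eps `^ (- r%:R^-1) <= K%:R,
        (mlp_weights N)%:R <=
          C * (eps `^ (- (3 / r%:R))
               + eps `^ (- r%:R^-1) * (ln (eps `^ (- (1 + r%:R^-1)))) ^+ 2) &
        forall (f g : R -> R) (cf : nat -> R),
          (fun n => L2norm01 (sine_partial cf n \- f)) @ \oo --> 0%E ->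
          sobolev2 r f g ->
          (L2norm01 g <= 1%:E)%E ->
          forall t : R, 0 <= t <= 1 ->
          (L2norm01 (fun x => (heat_sol alpha cf x t - net_out N cf x t)%R)
             <= eps%:E)%E].
Proof.
move=> al0 r0.
pose A := (Num.truncn (expR 1 * (2 * pi) + r%:R + 9 : R)).+1.
have hA : expR 1 * (2 * pi) + r%:R + 9 <= A%:R :> R by apply: ltW; exact: truncnS_gt.
(* With J = A K and K + 4 <= 5K, the weight count 2 K J (K + 4) + 1 is at most (10A + 1) K^3, and K
   <= 2P contributes the factor 8. [A] depends on [r] alone. *)
exists (8 * (10 * A + 1)%:R), 1; split; first by rewrite mulr_gt0 // ltr0n addn1.
split => // eps eps01; have /andP[e0 e1] := eps01.
have [K [K0 PK KP eK]] := truncation_level R r eps r0 eps01.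
have d0 : 0 < eps / 8 by rewrite divr_gt0.
have [N [NW NP]] := heat_partial_mlp R alpha K (A * K) _ d0 al0.
exists K, N; split; first by rewrite mul1r.
  set P := eps `^ (- r%:R^-1) in PK KP *.
  have P0 : 0 <= P by exact: powR_ge0.
  have -> : eps `^ (- (3 / r%:R)) = P ^+ 3.
    by rewrite -powR_mulrn // -powRrM mulNr mulrC.
  apply: (@le_trans _ _ (8 * (10 * A + 1)%:R * P ^+ 3)); last first.
    by rewrite ler_wpM2l ?mulr_ge0 // lerDl mulr_ge0 ?sqr_ge0.
  apply: (@le_trans _ _ ((10 * A + 1) * K ^ 3)%:R).
    rewrite NW ler_nat; nia.
  rewrite natrM [8 * _]mulrC -mulrA ler_wpM2l // natrX.
  have -> : 8 * P ^+ 3 = (2 * P) ^+ 3 by ring.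
  by rewrite lerXn2r ?nnegrE ?mulr_ge0.
move=> f g cf Scvg fW g1 t /andP[t0 _].
have cb := sobolev_sine_coef_bound R r f g cf Scvg fW g1.
have kr0 : 0 < K%:R ^+ r :> R by rewrite exprn_gt0 // ltr0n.
have te : K%:R * expR (expR 1 * (2 * pi * K%:R) - (A * K)%:R) <= eps / 8.
  have := taylor_exponent R r A K K0 hA; set q := _ * expR _ => hq.
  rewrite -(@ler_pM2l _ (8 * K%:R ^+ r)) ?mulr_gt0 //.
  apply: le_trans hq _.
  have -> : 8 * K%:R ^+ r * (eps / 8) = eps * K%:R ^+ r by field.
  exact: eK.
(* Error budget: eps/2 for truncation at K, eps/8 for the uniform tail, eps/8 for the network and
   eps/8 for the Taylor polynomials. *)
apply: le_trans (heat_L2_error R r cf r0 cb alpha t (ltW al0) t0 _ K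
  (eps / 8 + eps / 8) (eps / 8) K0 d0 _ (net_out_continuous R K N cf t) _) _.
- by lra.
- move=> x x01; apply: le_trans (NP cf t x _ t0 x01) _; last by rewrite lerD2l.
  by move=> k; exact: coef_le1 cb _.
rewrite lee_fin.
have : (2 * K%:R ^+ r)^-1 <= eps / 2.
  rewrite invfM mulrC ler_pM2r ?invr_gt0 // -[leLHS]mul1r ler_pdivrMr //.
lra.
Qed.
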